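(* Let $n,m\ge 1$, let $\mathcal{E}$ and $\mathcal{I}$ be finite index sets, and for each $k\in\{0\}\cup\mathcal{E}\cup\mathcal{I}$ let $A_k\in\mathbb{S}_n$, $B_k\in\mathbb{R}^{n\times m}$, $c_k\in\mathbb{R}$ be given. Let $\{w_i\}_{i\in\mathcal{N}}$, $\mathcal{N}=\{1,\dots,n\}$, be an arbitrary basis of $\mathbb{R}^n$. Let $\mathcal{F}^{\mathrm{lifted}}$ and $\mathcal{F}_{\mathcal{P}}$ be the feasible sets of the lifted problem and of its parabolic relaxation associated with the basis $\{w_i\}_{i\in\mathcal{N}}$, as defined in the context. Then $\mathcal{F}_{\mathcal{P}}$ satisfies the comprehensive boundary property for $\mathcal{F}^{\mathrm{lifted}}$; that is, $\mathcal{F}_{\mathcal{P}}$ is a closed convex relaxation of $\mathcal{F}^{\mathrm{lifted}}$ and $\mathcal{F}^{\mathrm{lifted}}\subseteq\partial\mathcal{F}_{\mathcal{P}}$.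
   Context: $\mathbb{S}_n$ is the space of real symmetric $n\times n$ matrices. For $k\in\{0\}\cup\mathcal{E}\cup\mathcal{I}$ define the affine function $\bar q_k:\mathbb{R}^{n\times m}\times\mathbb{S}_n\to\mathbb{R}$ by $\bar q_k(Y,X)=\mathrm{tr}\{A_kX\}+2\,\mathrm{tr}\{B_k^{\top}Y\}+c_k$. The lifted problem is to minimize $\bar q_0(Y,X)$ over $\mathcal{F}^{\mathrm{lifted}}$, where $\mathcal{F}^{\mathrm{lifted}}$ is the set of all $(Y,X)\in\mathbb{R}^{n\times m}\times\mathbb{S}_n$ with $\bar q_k(Y,X)=0$ for all $k\in\mathcal{E}$, $\bar q_k(Y,X)\le 0$ for all $k\in\mathcal{I}$, and $X=YY^{\top}$. The parabolic relaxation is to minimize $\bar q_0(Y,X)$ over $\mathcal{F}_{\mathcal{P}}$, where $\mathcal{F}_{\mathcal{P}}$ is the set of all $(Y,X)\in\mathbb{R}^{n\times m}\times\mathbb{S}_n$ with $\bar q_k(Y,X)=0$ for all $k\in\mathcal{E}$, $\bar q_k(Y,X)\le 0$ for all $k\in\mathcal{I}$, and, for all $i,j\in\mathcal{N}$ (including $i=j$), $$(w_i+w_j)^{\top}X(w_i+w_j)\ge\|(w_i+w_j)^{\top}Y\|_2^2,\qquad (w_i-w_j)^{\top}X(w_i-w_j)\ge\|(w_i-w_j)^{\top}Y\|_2^2 .$$ Comprehensive boundary property: let $\mathcal{F}^{\mathrm{relax}}\subseteq\mathbb{R}^{n\times m}\times\mathbb{S}_n$ be a closed, convex relaxation of $\mathcal{F}^{\mathrm{lifted}}$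 (i.e. a closed convex set containing $\mathcal{F}^{\mathrm{lifted}}$). It satisfies the comprehensive boundary property for $\mathcal{F}^{\mathrm{lifted}}$ if $\mathcal{F}^{\mathrm{lifted}}\subseteq\partial\mathcal{F}^{\mathrm{relax}}$. Here $\partial S$ is the topological boundary in $\mathbb{R}^{n\times m}\times\mathbb{S}_n$: the points of the closure of $S$ that are not in the interior of $S$. *)

(* Defs.v *)
From HB Require Import structures.
From mathcomp Require Import all_boot all_order all_algebra.
From mathcomp Require Import all_classical all_reals all_analysis.

Set Implicit Arguments.
Unset Strict Implicit.
Unset Printing Implicit Defensive.

Import Order.TTheory GRing.Theory Num.Theory.
Import numFieldNormedType.Exports.

Local Open Scope classical_set_scope.
Local Open Scope ring_scope.

Section SymmetricMatrices.
Context {R : realType} {n : nat}.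

Definition is_symmx : {pred 'M[R]_n} := [pred X : 'M[R]_n | X^T == X].

Fact is_symmx_submod_closed : submod_closed is_symmx.
Proof.
split=> [|a X Y]; first by rewrite inE trmx0.
by rewrite !inE => /eqP XE /eqP YE; rewrite linearP /= XE YE.
Qed.

HB.instance Definition _ :=
  GRing.isSubmodClosed.Build R 'M[R]_n is_symmx is_symmx_submod_closed.

End SymmetricMatrices.

(* The space of symmetric matrices is a type of its own, and not a subset of
   'M[R]_n: for n > 1, symmetric matrices have empty interior in 'M[R]_n, so
   interiors and boundaries have to be computed among symmetric matrices. *)
Record symmx (R : realType) (n : nat) := SymMx {
  symmx_val :> 'M[R]_n ;
  symmxP : symmx_val \in is_symmx
}.

Section SymmetricMatrixSpace.
Context (R : realType) (n : nat).

HB.instance Definition _ := [isSub for @symmx_val R n].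
HB.instance Definition _ := [Choice of symmx R n by <:].
HB.instance Definition _ := [SubChoice_isSubZmodule of symmx R n by <:].
HB.instance Definition _ := [SubZmodule_isSubLmodule of symmx R n by <:].
HB.instance Definition _ := PseudoMetric.copy (symmx R n)
  (initial_topology (@symmx_val R n)).

End SymmetricMatrixSpace.

Notation lifted_space R n m := ('M[R]_(n, m) * symmx R n)%type.

(* Euclidean norm; the library's `|u| on matrices is the maximum norm. *)
Definition l2norm (R : realType) (m : nat) (u : 'rV[R]_m) : R :=
  Num.sqrt (\sum_j u 0 j ^+ 2).

Definition boundary (T : topologicalType) (S : set T) : set T :=
  closure S `\` interior S.

Section Problems.
Context (R : realType) (n m : nat).
Implicit Types (YX : lifted_space R n m) (w : n.-tuple 'cV[R]_n).

Definition qbar (A : symmx R n) (B : 'M[R]_(n, m)) (c : R) YX : R :=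
  \tr (A *m YX.2) + 2 * \tr (B^T *m YX.1) + c.

(* The data are indexed by option K: None is the index 0 of the objective, and
   the constraint indices form the subsets E (equalities) and I (inequalities)
   of K. The feasible sets do not depend on the objective. *)
Definition qbar_constraints (K : finType) (E I : {set K})
    (A : option K -> symmx R n) (B : option K -> 'M[R]_(n, m))
    (c : option K -> R) : set (lifted_space R n m) :=
  [set YX |
    (forall k, k \in E ->
       qbar (A (Some k)) (B (Some k)) (c (Some k)) YX = 0) /\
    (forall k, k \in I ->
       qbar (A (Some k)) (B (Some k)) (c (Some k)) YX <= 0)].

Definition F_lifted (K : finType) (E I : {set K})
    (A : option K -> symmx R n) (B : option K -> 'M[R]_(n, m))
    (c : option K -> R) : set (lifted_space R n m) :=
  [set YX | qbar_constraints E I A B c YX /\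
    (YX.2 : 'M[R]_n) = YX.1 *m YX.1^T].

Definition parabolic_ineq (v : 'cV[R]_n) YX : Prop :=
  l2norm (v^T *m YX.1) ^+ 2 <= (v^T *m YX.2 *m v) 0 0.

Definition F_parabolic (K : finType) (E I : {set K})
    (A : option K -> symmx R n) (B : option K -> 'M[R]_(n, m))
    (c : option K -> R) w : set (lifted_space R n m) :=
  [set YX | qbar_constraints E I A B c YX /\
    (forall i j : 'I_n,
       parabolic_ineq (tnth w i + tnth w j) YX /\
       parabolic_ineq (tnth w i - tnth w j) YX)].

Definition closed_convex_relaxation (Flift Frelax : set (lifted_space R n m)) :
    Prop :=
  [/\ closed Frelax,
      @convex_set R (lifted_space R n m) Frelax
    & Flift `<=` Frelax].

Definition comprehensive_boundary_property
    (Flift Frelax : set (lifted_space R n m)) : Prop :=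
  closed_convex_relaxation Flift Frelax /\ Flift `<=` boundary Frelax.

End Problems.

(* Main.v *)
Require Import Defs.
From HB Require Import structures.
From mathcomp Require Import all_boot all_order all_algebra.
From mathcomp Require Import all_classical all_reals all_analysis.
From mathcomp Require Import ring lra.

Set Implicit Arguments.
Unset Strict Implicit.
Unset Printing Implicit Defensive.

Import Order.TTheory GRing.Theory Num.Theory.
Import numFieldNormedType.Exports.

Local Open Scope classical_set_scope.
Local Open Scope ring_scope.

(** Each constraint defining the parabolic relaxation is continuous, so the
    feasible set is closed.  Each constraint is also convex: it is either affine
    or of the form |v^T Y|^2 <= v^T X v, with a left-hand side convex in Y and a
    right-hand side linear in X ([parabolic_ineq_conv]).  When X = Y Y^T, every
    parabolic inequality holds with equality ([parabolic_ineq_lifted]), so a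
    lifted feasible point is feasible for the relaxation.

    Equality also puts such a point on the boundary.  Moving from (Y, X) to
    (Y, X - t I) lowers v^T X v by t |v|^2 and leaves |v^T Y|^2 unchanged, so for
    v != 0 the inequality fails for all t > 0 ([parabolic_ineq_not_interior]).
    This applies to v = w_0 + w_0, which is nonzero because the vectors w_i form
    a basis; the other constraints only make the feasible set smaller. *)

Lemma continuous_sum (R : realType) (T : topologicalType) (J : finType)
    (f : J -> T -> R) :
  (forall j, continuous (f j)) -> continuous (fun t => \sum_j f j t).
Proof.
by move=> f_cont; apply: continuous_big => //; exact: add_continuous.
Qed.

Lemma continuous_mulmx (R : realType) (T : topologicalType) (p q r : nat)
    (f : T -> 'M[R]_(p, q)) (g : T -> 'M[R]_(q, r)) :
  (forall i j, continuous (fun t => f t i j)) ->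
  (forall i j, continuous (fun t => g t i j)) ->
  forall i j, continuous (fun t => (f t *m g t) i j).
Proof.
move=> f_cont g_cont i j; under eq_fun do rewrite mxE.
apply: continuous_sum => k t.
by apply: cvgM; [exact: f_cont|exact: g_cont].
Qed.

Lemma l2norm_sqr (R : realType) (m : nat) (u : 'rV[R]_m) :
  l2norm u ^+ 2 = \sum_j u 0 j ^+ 2.
Proof. by rewrite sqr_sqrtr// sumr_ge0// => j _; exact: sqr_ge0. Qed.

Lemma l2norm_sqr_mulmx (R : realType) (m : nat) (u : 'rV[R]_m) :
  l2norm u ^+ 2 = (u *m u^T) 0 0.
Proof.
by rewrite l2norm_sqr mxE; apply: eq_bigr => j _; rewrite mxE expr2.
Qed.

Lemma l2norm_sqr_conv (R : realType) (m : nat) (u v : 'rV[R]_m) (t : R) :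
  0 <= t -> t <= 1 ->
  l2norm (t *: u + (1 - t) *: v) ^+ 2 <=
    t * l2norm u ^+ 2 + (1 - t) * l2norm v ^+ 2.
Proof.
move=> t0 t1; rewrite !l2norm_sqr !mulr_sumr -big_split/=.
apply: ler_sum => j _; rewrite !mxE -subr_ge0.
rewrite (_ : _ - _ = t * (1 - t) * (u 0 j - v 0 j) ^+ 2); last by ring.
by rewrite mulr_ge0 ?sqr_ge0// mulr_ge0// subr_ge0.
Qed.

Lemma l2norm_sqr_gt0 (R : realType) (m : nat) (u : 'rV[R]_m) :
  u != 0 -> 0 < l2norm u ^+ 2.
Proof.
move=> u0; rewrite lt0r sqr_ge0 andbT l2norm_sqr.
rewrite psumr_eq0 => [|j _]; last exact: sqr_ge0.
apply: contra u0 => /allP u0; apply/eqP/rowP => j; rewrite mxE.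
by have := u0 j (mem_index_enum _); rewrite sqrf_eq0 => /eqP.
Qed.

Section LiftedSpace.
Context (R : realType) (n m : nat).
Implicit Types (YX : lifted_space R n m) (v : 'cV[R]_n).

Lemma continuous_fst_entry (i : 'I_n) (j : 'I_m) :
  continuous (fun YX => YX.1 i j).
Proof.
move=> YX; apply: (@continuous_comp _ _ _ fst (fun Y : 'M[R]_(n, m) => Y i j)).
  exact: cvg_fst.
exact: coord_continuous.
Qed.

Lemma continuous_snd_entry (i j : 'I_n) :
  continuous (fun YX => (YX.2 : 'M[R]_n) i j).
Proof.
move=> YX.
apply: (@continuous_comp _ _ _ snd (fun X : symmx R n => (X : 'M[R]_n) i j)).
  exact: cvg_snd.
apply: (@continuous_comp _ _ _ (@symmx_val R n) (fun X : 'M[R]_n => X i j)).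
  exact: initial_continuous.
exact: coord_continuous.
Qed.

Lemma continuous_qbar (A : symmx R n) (B : 'M[R]_(n, m)) (c : R) :
  continuous (qbar A B c).
Proof.
move=> YX; rewrite /qbar /mxtrace; apply: cvgD; last exact: cvg_cst.
apply: cvgD; last apply: (cvgM (cvg_cst _)).
  apply: continuous_sum => i; apply: continuous_mulmx => j k.
    by move=> ?; exact: cvg_cst.
  exact: continuous_snd_entry.
apply: continuous_sum => i; apply: continuous_mulmx => j k.
  by move=> ?; exact: cvg_cst.
exact: continuous_fst_entry.
Qed.

Lemma closed_parabolic_ineq v :
  closed [set YX : lifted_space R n m | parabolic_ineq v YX].
Proof.
pose gap (YX : lifted_space R n m) : R :=
  (v^T *m YX.2 *m v) 0 0 - \sum_(j < m) (v^T *m YX.1) 0 j ^+ 2.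
have -> : [set YX | @parabolic_ineq R n m v YX] = gap @^-1` [set x | 0 <= x].
  by apply/seteqP; split=> YX /=;
    rewrite /parabolic_ineq /gap l2norm_sqr subr_ge0.
apply: (continuous_closedP _).1; last exact: closed_ge.
have vY_cont j : continuous (fun YX => (v^T *m YX.1) 0 j).
  by apply: continuous_mulmx => [? ? ?|]; [exact: cvg_cst|
    exact: continuous_fst_entry].
have vX_cont i j :
    continuous (fun YX : lifted_space R n m => (v^T *m YX.2) i j).
  by apply: continuous_mulmx => [? ? ?|]; [exact: cvg_cst|
    exact: continuous_snd_entry].
have vXv_cont :
    continuous (fun YX : lifted_space R n m => (v^T *m YX.2 *m v) 0 0).
  by apply: continuous_mulmx => // ? ? ?; exact: cvg_cst.
move=> YX; apply: cvgB; first exact: vXv_cont.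
by apply: continuous_sum => j ?; apply: cvgM; exact: vY_cont.
Qed.

Lemma qbar_conv (A : symmx R n) (B : 'M[R]_(n, m)) (c t : R) YX YX' :
  qbar A B c (t *: YX + (1 - t) *: YX') =
    t * qbar A B c YX + (1 - t) * qbar A B c YX'.
Proof.
rewrite /qbar/= !mulmxDr -!scalemxAr !mxtraceD !mxtraceZ.
by ring.
Qed.

Lemma parabolic_ineq_conv v (t : R) YX YX' : 0 <= t -> t <= 1 ->
  parabolic_ineq v YX -> parabolic_ineq v YX' ->
  parabolic_ineq v (t *: YX + (1 - t) *: YX').
Proof.
rewrite /parabolic_ineq/= => t0 t1 ineq ineq'.
rewrite !mulmxDr -!scalemxAr mulmxDl -!scalemxAl.
apply: le_trans (l2norm_sqr_conv _ _ t0 t1) _.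
rewrite [leRHS]mxE [X in _ <= X + _]mxE [X in _ <= _ + X]mxE.
by apply: lerD; apply: ler_wpM2l; rewrite ?subr_ge0.
Qed.

Lemma parabolic_ineq_lifted v YX :
  (YX.2 : 'M[R]_n) = YX.1 *m YX.1^T ->
  l2norm (v^T *m YX.1) ^+ 2 = (v^T *m YX.2 *m v) 0 0.
Proof. by move=> ->; rewrite l2norm_sqr_mulmx trmx_mul trmxK !mulmxA. Qed.

Fact symmx1_subproof : (1%:M : 'M[R]_n) \in @is_symmx R n.
Proof. by rewrite inE trmx1. Qed.

(** The identity matrix, as an element of the space of symmetric matrices. *)
Definition symmx1 : symmx R n := SymMx symmx1_subproof.

Lemma continuous_sub_scale_symmx1 (X : symmx R n) :
  continuous (fun t : R => X - t *: symmx1).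
Proof.
apply: continuous_comp_initial => t /=.
apply: cvgB; first exact: cvg_cst.
by apply: cvgZ; [exact: cvg_id|exact: cvg_cst].
Qed.

Lemma parabolic_ineq_not_interior v YX : v != 0 ->
  (YX.2 : 'M[R]_n) = YX.1 *m YX.1^T ->
  ~ interior [set YX' | parabolic_ineq v YX'] YX.
Proof.
move=> v0 lifted int.
pose path (t : R) : lifted_space R n m := (YX.1, YX.2 - t *: symmx1).
(* The limit is one-sided because the inequality fails only for t > 0. *)
have path_cvg : path t @[t --> 0^'+] --> YX.
  apply: cvg_at_right_filter.
  rewrite [X in _ --> X](_ : YX = path 0); last first.
    by rewrite /path scale0r subr0 -surjective_pairing.
  exact: (cvg_pair (cvg_cst _) (@continuous_sub_scale_symmx1 YX.2 0)).
have [t [t0]] : exists t : R, 0 < t /\ parabolic_ineq v (path t).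
  apply: (@filter_ex _ (0^'+)); apply: filterI; first exact: nbhs_right_gt.
  exact: path_cvg int.
rewrite /parabolic_ineq/= (parabolic_ineq_lifted _ lifted).
rewrite mulmxBr -scalemxAr mulmx1 mulmxBl -scalemxAl.
rewrite [leRHS]mxE [X in _ <= _ + X]mxE [X in _ <= _ - X]mxE.
have := l2norm_sqr_gt0 (u := v^T); rewrite l2norm_sqr_mulmx trmxK trmx_eq0.
by move=> /(_ v0) /(mulr_gt0 t0) tv; lra.
Qed.

End LiftedSpace.

Section Relaxation.
Context (R : realType) (n m : nat) (K : finType) (E I : {set K}).
Context (A : option K -> symmx R n) (B : option K -> 'M[R]_(n, m)).
Context (c : option K -> R) (w : n.-tuple 'cV[R]_n).

Lemma closed_F_parabolic : closed (F_parabolic E I A B c w).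
Proof.
pose q k := qbar (A (Some k)) (B (Some k)) (c (Some k)).
rewrite (_ : F_parabolic _ _ _ _ _ _ =
  (\bigcap_(k in [set` E]) (q k @^-1` [set x | x = 0]) `&`
   \bigcap_(k in [set` I]) (q k @^-1` [set x | x <= 0])) `&`
  \bigcap_(ij in [set: 'I_n * 'I_n])
    ([set YX | parabolic_ineq (tnth w ij.1 + tnth w ij.2) YX] `&`
     [set YX | parabolic_ineq (tnth w ij.1 - tnth w ij.2) YX])); last first.
  apply/seteqP; split=> [YX [[eqs ineqs] pars]|YX [[eqs ineqs] pars]].
    by split=> [|[i j] _]; [split|exact: pars].
  by split=> [|i j]; [split|exact: (pars (i, j) Logic.I)].
apply: closedI; first apply: closedI; apply: closed_bigI => k _.
- by apply: (continuous_closedP _).1; [exact: continuous_qbar|exact: closed_eq].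
- by apply: (continuous_closedP _).1; [exact: continuous_qbar|exact: closed_le].
- by apply: closedI; exact: closed_parabolic_ineq.
Qed.

Lemma convex_F_parabolic :
  @convex_set R (lifted_space R n m) (F_parabolic E I A B c w).
Proof.
move=> x y l; rewrite !inE => -[[eqs ineqs] pars] [[eqs' ineqs'] pars'].
have l0 : 0 <= l%:num by [].
have l1 : l%:num <= 1 by [].
change (F_parabolic E I A B c w (l%:num *: x + (1 - l%:num) *: y)).
split=> [|i j]; first split=> k kP.
- by rewrite qbar_conv eqs// eqs'// !mulr0 addr0.
- rewrite qbar_conv -oppr_ge0 opprD -!mulrN.
  by rewrite addr_ge0// mulr_ge0// ?subr_ge0// oppr_ge0; auto.
- have [? ?] := pars i j; have [? ?] := pars' i j.
  by split; exact: parabolic_ineq_conv.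
Qed.

Lemma F_lifted_sub_parabolic :
  F_lifted E I A B c `<=` F_parabolic E I A B c w.
Proof.
move=> YX [cons lifted]; split=> // i j.
by split; rewrite /parabolic_ineq (parabolic_ineq_lifted _ lifted).
Qed.

End Relaxation.

Theorem theorem1 (R : realType) (n m : nat) (n_gt0 : (0 < n)%N)
    (m_gt0 : (0 < m)%N) (K : finType) (E I : {set K})
    (A : option K -> symmx R n) (B : option K -> 'M[R]_(n, m))
    (c : option K -> R) (w : n.-tuple 'cV[R]_n)
    (w_basis : basis_of fullv w) :
  comprehensive_boundary_property
    (F_lifted E I A B c) (F_parabolic E I A B c w).
Proof.
split.
  split; [exact: closed_F_parabolic|exact: convex_F_parabolic|].
  exact: F_lifted_sub_parabolic.
move=> YX lifted; split.
  exact/subset_closure/F_lifted_sub_parabolic.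
pose i0 := Ordinal n_gt0.
(* This is 2 w_0, the vector of the inequality with indices i = j = 0. *)
have v0 : tnth w i0 + tnth w i0 != 0.
  rewrite -mulr2n -scaler_nat scaler_eq0 pnatr_eq0/=.
  exact: free_not0 (basis_free w_basis) (mem_tnth i0 w).
case: lifted => _ lifted int.
apply: (parabolic_ineq_not_interior v0 lifted).
apply: interiorS int => YX' [_ pars].
by have [] := pars i0 i0.
Qed.
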